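(* Let $(\mathcal{S},\mathcal{T})$ be a medium and let $\mathbf{m}=\tau_1\cdots\tau_{2n}$ be a 2-gon for a state $S$, with $(S_i)$ the sequence of states produced by $\mathbf{m}$ from $S$. The following three conditions are equivalent: (i) $\mathbf{m}$ is a regular circuit for $S$; (ii) for any $1\le i\le 2n-1$, the message $\tau_i\cdots\tau_{2n}\tau_1\cdots\tau_{i-1}$ is a 2-gon for the state $S_{i-1}$; (iii) for each $1\le i\le n$, the opposite tokens $\tau_i$ and $\tau_{i+n}$ are mutual reverses.
   Context: A token system is a pair $(\mathcal{S},\mathcal{T})$ where $\mathcal{S}$ is a set of states with $|\mathcal{S}|\ge 2$ and $\mathcal{T}$ is a nonempty set of tokens, each token being a map $\tau:\mathcal{S}\to\mathcal{S}$, $S\mapsto S\tau$, different from the identity. A token $\tilde\tau$ is a reverse of $\tau$ if for all distinct $S,V$: $S\tau=V\iff V\tilde\tau=S$. A message is a finite string $\mathbf{m}=\tau_1\cdots\tau_k$ of tokens acting by $S\mathbf{m}=(\cdots(S\tau_1)\cdots)\tau_k$ (empty message = identity), producing states $S_0=S$, $S_i=S\tau_1\cdots\tau_i$. It is consistent if it does not contain both a token and its reverse; vacuous if $\{1,\dots,k\}$ can be partitioned into pairs $\{i,j\}$ with $\tau_i,\tau_j$ mutual reverses; stepwise effective for $S$ if $S_j\neq S_{j-1}$ for all $j$; concise for $S$ if stepwise effective for $S$, consistent, and no token occurs twice; closed for $S$ if stepwise effective for $S$ and $S\mathbf{m}=S$. A medium is a token system with [M1] for any distinct states $S,V$ some message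 concise for $S$ transforms $S$ into $V$, and [M2] every message closed for some state is vacuous. If $\mathbf{p}$ is concise for $S$ with $S\mathbf{p}=V$ and $\mathbf{q}$ is concise for $V$ with $V\mathbf{q}=S$, the concatenation $\mathbf{p}\mathbf{q}$ is called a 2-gon for $S$. A closed message $\mathbf{m}=\tau_1\cdots\tau_{2n}$ for $S$ is a regular circuit for $S$ if for every $1\le i\le n$ the message $\tau_i\cdots\tau_{i+n-1}$ is concise for $S_{i-1}$. For $1\le i\le n$, the tokens $\tau_i$ and $\tau_{i+n}$ are called opposite. *)

(* Defs.v *)
From HB Require Import structures.
From mathcomp Require Import all_boot.
From mathcomp Require Import boolp classical_sets.

Set Implicit Arguments.
Unset Strict Implicit.
Unset Printing Implicit Defensive.

(* Self-maps of the state set, equipped with the classical equality,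
   so that [\in] and [uniq] apply to messages over any state type. *)
Definition selfmap (St : Type) : Type := St -> St.
HB.instance Definition _ (St : Type) := gen_eqMixin (selfmap St).

Definition is_token_system (St : Type) (T : set (selfmap St)) : Prop :=
  [/\ exists S V : St, S <> V,
      exists tau, T tau
    & forall tau, T tau -> tau <> id].

Definition is_reverse (St : Type) (tau' tau : selfmap St) : Prop :=
  forall S V : St, S <> V -> (tau S = V <-> tau' V = S).

Definition mutual_reverses (St : Type) (tau tau' : selfmap St) : Prop :=
  is_reverse tau' tau /\ is_reverse tau tau'.

Definition is_message (St : Type) (T : set (selfmap St))
    (m : seq (selfmap St)) : Prop :=
  forall tau, tau \in m -> T tau.

Definition act (St : Type) (S : St) (m : seq (selfmap St)) : St :=
  foldl (fun V (tau : selfmap St) => tau V) S m.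

(* S_i, for 0 <= i <= size m. *)
Definition state (St : Type) (S : St) (m : seq (selfmap St)) (i : nat) : St :=
  act S (take i m).

(* tau_i, numbered from 1; the default value [id] is only reached when i is out
   of range. *)
Definition token_at (St : Type) (m : seq (selfmap St)) (i : nat) : selfmap St :=
  nth (id : selfmap St) m i.-1.

(* The two tokens are not required to be distinct: a message that contains a
   token which is its own reverse is inconsistent. *)
Definition consistent (St : Type) (m : seq (selfmap St)) : Prop :=
  ~ exists tau tau', [/\ tau \in m, tau' \in m & is_reverse tau' tau].

Definition vacuous (St : Type) (m : seq (selfmap St)) : Prop :=
  exists P : {set {set 'I_(size m)}},
    finset.partition P [set: 'I_(size m)]%SET /\
    forall B, B \in P ->
      exists i j : 'I_(size m),
        [/\ i != j, B = [set i; j]%SET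
          & mutual_reverses (token_at m i.+1) (token_at m j.+1)].

Definition stepwise_effective (St : Type) (S : St)
    (m : seq (selfmap St)) : Prop :=
  forall j, 1 <= j <= size m -> state S m j <> state S m j.-1.

Definition concise (St : Type) (S : St) (m : seq (selfmap St)) : Prop :=
  [/\ stepwise_effective S m, consistent m & uniq m].

Definition closed_for (St : Type) (S : St) (m : seq (selfmap St)) : Prop :=
  stepwise_effective S m /\ act S m = S.

Definition is_medium (St : Type) (T : set (selfmap St)) : Prop :=
  [/\ is_token_system T,
      forall S V : St, S <> V ->
        exists m, [/\ is_message T m, concise S m & act S m = V]
    & forall m (S : St), is_message T m -> closed_for S m -> vacuous m].

Definition two_gon (St : Type) (T : set (selfmap St)) (S : St)
    (m : seq (selfmap St)) : Prop :=
  exists p q (V : St),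
    [/\ m = p ++ q, is_message T p /\ is_message T q,
        concise S p /\ act S p = V & concise V q /\ act V q = S].

Definition regular_circuit (St : Type) (T : set (selfmap St)) (n : nat)
    (S : St) (m : seq (selfmap St)) : Prop :=
  [/\ is_message T m, size m = 2 * n, closed_for S m
    & forall i, 1 <= i <= n ->
        concise (state S m i.-1) (take n (drop i.-1 m))].

(* Main.v *)
(* A 2-gon [p ++ q] is closed, hence vacuous; as [p] and [q] are consistent,
   reversal exchanges their contents, so they have the same length [n] and the
   2-gon lists [2 * n] distinct tokens.  If the windows of length [n] are
   consistent, the reverse of the [i]-th token sits at a position [>= i + n],
   and since distinct tokens have distinct reverses this forces position
   [i + n].  Conversely, the condition "opposite tokens are mutual reverses" is
   invariant under rotation and makes both halves of the message concise. *)
Require Import Defs.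
From HB Require Import structures.
From mathcomp Require Import all_boot.
From mathcomp Require Import zify.
From mathcomp Require Import boolp classical_sets.

Set Implicit Arguments.
Unset Strict Implicit.
Unset Printing Implicit Defensive.

Lemma is_reverse_sym (St : Type) (t t' : selfmap St) :
  is_reverse t' t -> is_reverse t t'.
Proof. by move=> h U V UV; split=> /h; apply; apply: nesym. Qed.

(** A state moved by one candidate is the target of a transition of [t], which the other candidate
    must undo in the same way; the remaining states are fixed by both. *)
Lemma is_reverse_unique (St : Type) (t t1 t2 : selfmap St) :
  is_reverse t1 t -> is_reverse t2 t -> t1 = t2.
Proof.
move=> h1 h2; apply: funext => V.
have [e1|n1] := pselect (t1 V = V); last by apply/esym/(h2 _ _ n1)/h1.
have [e2|n2] := pselect (t2 V = V); first by rewrite e1 e2.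
by apply/(h1 _ _ n2)/h2.
Qed.

Lemma act_cat (St : Type) (S : St) p q : act S (p ++ q) = act (act S p) q.
Proof. exact: foldl_cat. Qed.

Lemma stepwise_effective_cons (St : Type) (S : St) (t : selfmap St) m :
  stepwise_effective S (t :: m) <-> t S <> S /\ stepwise_effective (t S) m.
Proof.
split=> [h|[h0 h] [|[|j]] //=].
  split; first by have := h 1 isT; rewrite /state /= take0.
  by case=> [//|j] hj; apply: (h j.+2).
- by rewrite /state /= take0.
- by move=> hj; apply: (h j.+1).
Qed.

Lemma stepwise_effective_cat (St : Type) (S : St) p q :
  stepwise_effective S (p ++ q) <->
  stepwise_effective S p /\ stepwise_effective (act S p) q.
Proof.
elim: p S => [|t p IH] S /=.
  by split=> [h|[]//]; split=> // -[|j].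
by rewrite !stepwise_effective_cons IH; tauto.
Qed.

Lemma vacuous_has_reverse (St : Type) (m : seq (selfmap St)) t :
  vacuous m -> t \in m -> exists2 t', t' \in m & is_reverse t' t.
Proof.
move=> [P [partP hP]] tm.
have ltk : index t m < size m by rewrite index_mem.
have : Ordinal ltk \in finset.cover P by rewrite (finset.cover_partition partP) finset.in_setT.
case/finset.bigcupP=> B /hP [i [j [_ -> [ij ji]]]].
rewrite finset.in_set2 => /orP[] /eqP /(congr1 val) /= e.
- exists (token_at m j.+1); first by rewrite /token_at mem_nth ?ltn_ord.
  by move: ij; rewrite /token_at /= -e nth_index.
- exists (token_at m i.+1); first by rewrite /token_at mem_nth ?ltn_ord.
  by move: ji; rewrite /token_at /= -e nth_index.
Qed.

Lemma two_gon_closed {St : Type} {T : set (selfmap St)} {S : St} {m} :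
  two_gon T S m -> is_message T m /\ closed_for S m.
Proof.
move=> [p [q [V [-> [Tp Tq] [[sp _ _] pV] [[sq _ _] qS]]]]].
split; first by move=> t; rewrite mem_cat => /orP[/Tp|/Tq].
by split; rewrite ?act_cat ?pV // stepwise_effective_cat pV.
Qed.

(** Choosing reverses embeds [p] into [q]: a token is recovered as the reverse of its reverse, so
    the choice is injective. *)
Lemma leq_size_reverse (St : Type) (p q : seq (selfmap St)) :
  uniq p -> (forall t, t \in p -> exists2 t', t' \in q & is_reverse t' t) ->
  size p <= size q.
Proof.
move=> up h.
have /choice[f hf] : forall t : selfmap St,
    exists t', t \in p -> t' \in q /\ is_reverse t' t.
  move=> t; have [/h[t' ? ?]|_] := boolP (t \in p); first by exists t'.
  (* Outside [p] the value of the choice function is arbitrary. *)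
  by exists id.
rewrite -(size_map f); apply: uniq_leq_size.
  rewrite map_inj_in_uniq // => x y /hf[_ rx] /hf[_ ry] e.
  apply: is_reverse_unique (is_reverse_sym rx) _.
  by rewrite e; apply: is_reverse_sym.
by move=> _ /mapP[t /hf[ft _] ->].
Qed.

(** Consistency of each concise part pushes reverses into the other part, so the cut of any 2-gon
    decomposition is forced to lie at [n]. *)
Lemma two_gon_halves (St : Type) (T : set (selfmap St)) n (S : St) m :
  is_medium T -> size m = 2 * n -> two_gon T S m ->
  uniq m /\ concise S (take n m).
Proof.
move=> [_ _ M2] sz tg; have [Tm cm] := two_gon_closed tg.
have rev_m t := @vacuous_has_reverse _ m t (M2 _ _ Tm cm).
case: tg => p [q [V [e _ [cp pV] [cq _]]]]; rewrite e in sz rev_m *.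
have [[_ conp up] [_ conq uq]] := (cp, cq).
have pq t : t \in p -> exists2 t', t' \in q & is_reverse t' t.
  move=> tp; have [|t'] := rev_m t; first by rewrite mem_cat tp.
  rewrite mem_cat => /orP[t'p r|]; last by exists t'.
  by case: conp; exists t, t'.
have qp t : t \in q -> exists2 t', t' \in p & is_reverse t' t.
  move=> tq; have [|t'] := rev_m t; first by rewrite mem_cat tq orbT.
  rewrite mem_cat => /orP[|t'q r]; first by exists t'.
  by case: conq; exists t, t'.
have leq_pq := leq_size_reverse up pq; have leq_qp := leq_size_reverse uq qp.
have sp : size p = n by move: sz; rewrite size_cat; lia.
rewrite take_size_cat //; split=> //.
(* A token common to both parts would have its reverse in [p] too, against the consistency of
   [p]. *)
rewrite cat_uniq up uq andbT; apply/hasPn => t tq; apply/negP => tp.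
have [t' t'p r] := qp t tq.
by case: conp; exists t, t'.
Qed.

Local Notation tok := (nth (id : selfmap _)).

(** Condition (iii) with positions counted from 0; one direction suffices because reversal is
    symmetric. *)
Definition antipodal {St : Type} n (m : seq (selfmap St)) : Prop :=
  forall i, i < n -> is_reverse (tok m (i + n)) (tok m i).

Lemma antipodalP (St : Type) n (m : seq (selfmap St)) :
  antipodal n m <->
  forall i, 1 <= i <= n -> mutual_reverses (token_at m i) (token_at m (i + n)).
Proof.
split=> [h [//|i] /h r | h i ltin].
  by split=> //; apply: is_reverse_sym.
by have [] := h i.+1 ltin.
Qed.

Lemma antipodal_rot (St : Type) n k (m : seq (selfmap St)) :
  size m = 2 * n -> k <= size m -> antipodal n m -> antipodal n (rot k m).
Proof.
move=> sz + am; elim: k => [|k IH] ltk; first by rewrite rot0.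
rewrite rotS //; move: (IH (ltnW ltk)); rewrite /antipodal.
have: size (rot k m) = 2 * n by rewrite size_rot.
case: (rot k m) => [|t s] /=; first by rewrite /rot /=.
rewrite rot1_cons => szs as_ i ltin; rewrite !nth_rcons.
have -> : i < size s by lia.
case: ltnP => [lt|ge].
  by have lt' : i.+1 < n; [lia|exact: (as_ i.+1 lt')].
(* Only the pair at [i = n - 1] wraps around: it is the old pair at positions 0 and [n], with its
   members exchanged. *)
have -> : i + n == size s by lia.
have r0 := as_ 0 (leq_ltn_trans (leq0n i) ltin).
apply: is_reverse_sym; move: r0 => /=.
by have -> : 0 + n = i.+1 by lia.
Qed.

(** Entries are distinct and reverses unique, so mutually reverse tokens sit exactly [n] apart, too
    far for a half of length [n]. *)
Lemma antipodal_concise (St : Type) n (S : St) m :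
  size m = 2 * n -> uniq m -> stepwise_effective S m -> antipodal n m ->
  concise S (take n m) /\ concise (state S m n) (drop n m).
Proof.
move=> sz um; rewrite -{1}(cat_take_drop n m).
rewrite stepwise_effective_cat => -[s1 s2] am.
have inj i j : i < 2 * n -> j < 2 * n -> tok m i = tok m j -> i = j.
  by move=> lti ltj /eqP; rewrite nth_uniq ?sz // => /eqP.
split; split; rewrite ?take_uniq ?drop_uniq // => -[t [t' []]];
  move=> /(nthP (id : selfmap St))[a + <-] /(nthP (id : selfmap St))[b + <-].
- rewrite size_takel => [lta ltb|]; last by rewrite sz; lia.
  rewrite !nth_take // => /is_reverse_unique /(_ (am a lta)) e.
  by have := inj _ _ _ _ e; lia.
- rewrite size_drop sz !nth_drop => lta ltb; rewrite (addnC n a).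
  have lta' : a < n by lia.
  move=> /is_reverse_unique /(_ (is_reverse_sym (am a lta'))) e.
  by have := inj _ _ _ _ e; lia.
Qed.

Lemma windows_antipodal (St : Type) (T : set (selfmap St)) n (S : St) m :
  is_medium T -> size m = 2 * n -> two_gon T S m ->
  (forall k, k < n -> consistent (take n (drop k m))) -> antipodal n m.
Proof.
move=> hM sz tg win; have [um _] := two_gon_halves hM sz tg.
have [Tm cm] := two_gon_closed tg; case: hM => _ _ M2.
have in_window k i : k <= i -> i < k + n -> k < n ->
    tok m i \in take n (drop k m).
  move=> leki lti ltk; apply/(nthP (id : selfmap St)); exists (i - k).
    by rewrite size_takel ?size_drop ?sz; lia.
  by rewrite nth_take ?nth_drop ?subnKC //; lia.
(* The bound [d] on [n - k] makes the induction descend from [k = n - 1]. *)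
move=> k ltk; move: {2}(n - k) (leqnn (n - k)) => d.
elim: d k ltk => [|d IH] k ltk led; first lia.
have [|t' t'm r] := vacuous_has_reverse (t := tok m k) (M2 _ _ Tm cm).
  by apply: mem_nth; rewrite sz; lia.
case/(nthP (id : selfmap St)): t'm r => j; rewrite sz => ltj <- r.
have outside k' : k' < n -> k' <= k < k' + n -> ~ (k' <= j < k' + n).
  move=> ltk' hk hj; apply: (win k' ltk').
  by exists (tok m k), (tok m j); split=> //; apply: in_window; lia.
(* The window at 0 excludes [j < n]; the window at [k] then excludes [j < k + n]. *)
have gej : n <= j by have := outside 0; lia.
have gejk : k + n <= j by have := outside k ltk; lia.
have [<-//|nj] := eqVneq j (k + n).
(* Now [j - n > k] is already settled, so the tokens at [k] and [j - n] are both reverses of the one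
   at [j], hence equal. *)
have ltjn : j - n < n by lia.
have := IH (j - n) ltjn; rewrite subnK // => /(_ ltac:(lia)) r'.
have /eqP := is_reverse_unique (is_reverse_sym r) (is_reverse_sym r').
by rewrite nth_uniq // ?sz; lia.
Qed.

Lemma closed_rot {St : Type} {S : St} {m} k :
  closed_for S m -> closed_for (state S m k) (rot k m).
Proof.
rewrite /state /closed_for -{1 2}(cat_take_drop k m).
rewrite stepwise_effective_cat /rot act_cat => -[[s1 s2] e].
by rewrite stepwise_effective_cat act_cat e.
Qed.

(** For [k <= n] the window does not wrap around; thus the windows of a regular circuit are first
    halves of rotations. *)
Lemma take_rot_window {A : Type} n k (m : seq A) :
  size m = 2 * n -> k <= n -> take n (rot k m) = take n (drop k m).
Proof. by move=> sz lek; rewrite /rot takel_cat // size_drop; lia. Qed.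

Lemma antipodal_rot_two_gon (St : Type) (T : set (selfmap St)) n k (S : St) m :
  is_message T m -> size m = 2 * n -> uniq m -> closed_for S m ->
  antipodal n m -> k <= size m ->
  concise (state S m k) (take n (rot k m)) /\ two_gon T (state S m k) (rot k m).
Proof.
move=> Tm sz um cm am lek; have [se e] := closed_rot k cm.
have [||c1 c2] := antipodal_concise _ _ se (antipodal_rot sz lek am).
- by rewrite size_rot.
- by rewrite rot_uniq.
split=> //; exists (take n (rot k m)), (drop n (rot k m)).
exists (state (state S m k) (rot k m) n); split=> //.
- by rewrite cat_take_drop.
- by split=> t; [move=> /mem_take|move=> /mem_drop]; rewrite mem_rot => /Tm.
- by split=> //; rewrite -act_cat cat_take_drop.
Qed.

Theorem theorem10p1 (St : Type) (T : set (selfmap St)) (hM : is_medium T)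
    (n : nat) (S : St) (m : seq (selfmap St))
    (hsize : size m = 2 * n) (hm : two_gon T S m) :
  [<-> regular_circuit T n S m;
       forall i, 1 <= i <= 2 * n - 1 -> two_gon T (state S m i.-1) (rot i.-1 m);
       forall i, 1 <= i <= n ->
         mutual_reverses (token_at m i) (token_at m (i + n))].
Proof.
have [um _] := two_gon_halves hM hsize hm.
have [Tm cm] := two_gon_closed hm.
tfae.
- move=> [_ _ _ win] i lei.
  (* The windows start only at positions below [n], whereas the rotations range further;
     antipodality bridges the gap. *)
  have am : antipodal n m.
    by apply: (windows_antipodal hM hsize hm) => k ltk; case: (win k.+1 ltk).
  have lek : i.-1 <= size m by rewrite hsize; lia.
  by case: (antipodal_rot_two_gon Tm hsize um cm am lek).
- move=> rots; apply/antipodalP.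
  apply: (windows_antipodal hM hsize hm) => k ltk.
  (* The index is in range: [k < n] gives [k + 1 <= n <= 2 * n - 1]. *)
  have tgk := rots k.+1 ltac:(lia).
  have szk : size (rot k m) = 2 * n by rewrite size_rot.
  have [_ [_ con _]] := two_gon_halves hM szk tgk.
  by rewrite -(take_rot_window hsize) // ltnW.
- move=> /antipodalP am; split=> // i lei.
  rewrite -(take_rot_window hsize); last lia.
  have lek : i.-1 <= size m by rewrite hsize; lia.
  by case: (antipodal_rot_two_gon Tm hsize um cm am lek).
Qed.
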